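(* Let $q\in\mathbb{C}$ with $|q|<1$, and let $b,d\in\mathbb{C}$ with $(b;q)_\infty(d;q)_\infty\neq 0$. Then \[ \sum_{n=0}^{\infty}\left( \frac{1}{(b)_{\infty} (d)_{\infty}} - \frac{1}{(b)_n (d)_n} \right) = \frac{1}{(b)_{\infty} (d)_{\infty}} \Bigg\{ \sum_{k=1}^{\infty}\frac{q^k}{1-q^k} - \sum_{n=1}^{\infty}\frac{(-d)^n q^{n(n-1)/2}}{1-q^n} - \sum_{m=1}^{\infty}\frac{(b/q)_m q^m}{1-q^m} - \sum_{n=1}^{\infty}\frac{(-d)^n q^{n(n-1)/2}}{1-q^n} \sum_{m=1}^{\infty}\frac{(q^n)_m (b/q)_m q^m}{(q)_m} \Bigg\}. \]
   Context: Throughout, $|q|<1$ and $(A)_n=(A;q)_n=\prod_{i=0}^{n-1}(1-Aq^i)$ for $n\ge0$ (empty product $=1$), $(A)_\infty=(A;q)_\infty=\lim_{n\to\infty}(A;q)_n$. *)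

(* Defs.v *)
From Stdlib Require Import Reals.
From Coquelicot Require Import Coquelicot.

Open Scope C_scope.

Fixpoint qpoch (A q : C) (n : nat) : C :=
  match n with
  | O => 1
  | S m => qpoch A q m * (1 - A * q ^ m)
  end.

(* [CLim] and [CSeries] are total, like [Lim_seq] and [Series] over [R]: they
   are the limit, resp. the sum, only when it exists. *)
Definition CLim (u : nat -> C) : C :=
  @iota C_CompleteNormedModule (fun l : C => filterlim u eventually (locally l)).

Definition CSeries (a : nat -> C) : C :=
  @iota C_CompleteNormedModule (fun l : C => is_series a l).

Definition qpoch_inf (A q : C) : C := CLim (qpoch A q).

Lemma CLim_unique (u : nat -> C) (l : C) :
  filterlim u eventually (locally l) -> CLim u = l.
Proof.
  intros H.
  exact (@iota_filterlim_locally C_AbsRing C_CompleteNormedModule nat eventually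
           (Proper_StrongProper _ eventually_filter) u l H).
Qed.

Lemma CSeries_unique (a : nat -> C) (l : C) : is_series a l -> CSeries a = l.
Proof. exact (CLim_unique (sum_n a) l). Qed.

Definition CSeries1 (a : nat -> C) : C := CSeries (fun k => a (S k)).

Definition ex_series1 (a : nat -> C) : Prop := ex_series (fun k => a (S k)).

(* Main.v *)
Require Import Defs.
From Stdlib Require Import Reals Lra Lia FunctionalExtensionality.
From Coquelicot Require Import Coquelicot.

Open Scope C_scope.

(** Multiplying by [(b)_oo (d)_oo] turns the left-hand side into
    [sum_n (1 - (b q^n)_oo (d q^n)_oo)].  Put [c = b/q] and
      [L c   = sum_(m>=1) (1 - (c)_m) q^m / (1 - q^m)],
      [H_n c = sum_(m>=0) (q^(m+1))_(n-1) (c)_m q^m],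
      [e_n d = (-d)^n q^(n(n-1)/2) / (q)_n].
    The braces on the right-hand side equal
    [U c d = L c - sum_(n>=1) e_n d * H_n c].
    Telescoping gives [L c - L (cq) = 1 - (cq)_oo] and
    [H_n c - q^n H_n (cq) = (cq)_oo], and Euler's expansion
    [(d)_oo = sum_(n>=0) e_n d] follows by iterating its functional equation
    under [d -> dq].  As [e_n (dq) = q^n e_n d], these combine to
    [U c d - U (cq) (dq) = 1 - (b)_oo (d)_oo].  Summing this along the orbit
    [(c q^k, d q^k)], where [U] is [O(|q|^k)], gives the theorem without any
    exchange of summations. *)

(** * Limits and series of complex numbers *)

Lemma filterlim_C_iff (u : nat -> C) (l : C) :
  filterlim u eventually (locally l)
  <-> is_lim_seq (fun n => Cmod (u n - l)) 0.
Proof.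
  rewrite (@filterlim_locally_ball_norm C_AbsRing nat C_NormedModule eventually
             _).
  rewrite <- is_lim_seq_spec; unfold is_lim_seq', ball_norm.
  change (@norm C_AbsRing C_NormedModule) with Cmod.
  split; intros H eps; destruct (H eps) as [N HN]; exists N; intros n Hn;
    specialize (HN n Hn); revert HN; change (minus (u n) l) with (u n - l);
    rewrite Rminus_0_r, Rabs_pos_eq by apply Cmod_ge_0; auto.
Qed.

Lemma filterlim_C_squeeze (u : nat -> C) (l : C) (v : nat -> R) :
  (forall n, (Cmod (u n - l) <= v n)%R) -> is_lim_seq v 0 ->
  filterlim u eventually (locally l).
Proof.
  intros H Hv; apply filterlim_C_iff.
  apply is_lim_seq_le_le with (fun _ => 0%R) v; auto.
  - intros n; split; [apply Cmod_ge_0 | apply H].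
  - apply is_lim_seq_const.
Qed.

Lemma is_lim_seq_Cmod (u : nat -> C) (l : C) :
  filterlim u eventually (locally l) ->
  is_lim_seq (fun n => Cmod (u n)) (Cmod l).
Proof.
  intros H.
  exact (filterlim_comp _ _ _ _ _ _ _ _ H
           (@filterlim_norm C_AbsRing C_NormedModule l)).
Qed.

Lemma filterlim_Cmult (u v : nat -> C) (l m : C) :
  filterlim u eventually (locally l) -> filterlim v eventually (locally m) ->
  filterlim (fun n => u n * v n) eventually (locally (l * m)).
Proof.
  intros Hu Hv.
  apply filterlim_C_squeeze
    with (fun n => Cmod (u n) * Cmod (v n - m) + Cmod m * Cmod (u n - l))%R.
  - intros n; rewrite <- !Cmod_mult.
    replace (u n * v n - l * m) with (u n * (v n - m) + m * (u n - l)) by ring.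
    apply Cmod_triangle.
  - replace (Finite 0) with (Finite (Cmod l * 0 + Cmod m * 0)%R)
      by (f_equal; ring).
    apply is_lim_seq_plus'; apply is_lim_seq_mult'.
    + now apply is_lim_seq_Cmod.
    + now apply filterlim_C_iff.
    + apply is_lim_seq_const.
    + now apply filterlim_C_iff.
Qed.

Lemma CSeries_correct (a : nat -> C) : ex_series a -> is_series a (CSeries a).
Proof. now intros [l Hl]; rewrite (CSeries_unique _ _ Hl). Qed.

Lemma CSeries_ext (a b : nat -> C) :
  (forall n, a n = b n) -> CSeries a = CSeries b.
Proof.
  intros H; apply functional_extensionality in H; now rewrite H.
Qed.

Lemma is_series_Cext (a b : nat -> C) (l : C) :
  (forall n, a n = b n) -> is_series a l -> is_series b l.
Proof. exact (@is_series_ext C_AbsRing C_NormedModule a b l). Qed.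

Lemma is_series_Cminus (a b : nat -> C) (la lb : C) :
  is_series a la -> is_series b lb ->
  is_series (fun n => a n - b n) (la - lb).
Proof. exact (@is_series_minus C_AbsRing C_NormedModule a b la lb). Qed.

Lemma is_series_Cscal (c : C) (a : nat -> C) (l : C) :
  is_series a l -> is_series (fun n => c * a n) (c * l).
Proof. exact (@is_series_scal C_AbsRing C_NormedModule c a l). Qed.

Lemma is_series_Cfirst (a : nat -> C) (l : C) :
  is_series (fun n => a (S n)) l -> is_series a (a O + l).
Proof.
  intros H; apply is_series_decr_1.
  change (is_series (fun n => a (S n)) (a O + l - a O)).
  now replace (a O + l - a O) with l by ring.
Qed.

Lemma is_series_Ctail (a : nat -> C) (l : C) :
  is_series a l -> is_series (fun n => a (S n)) (l - a O).
Proof.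
  intros H; apply is_series_incr_1.
  change (is_series a (l - a O + a O)).
  now replace (l - a O + a O) with l by ring.
Qed.

(** Comparison test, with the triangle inequality for partial sums passed to the limit. The bound on
    the sum matters as much as convergence: it later yields the decay along the orbit. *)
Lemma CSeries_dominated (a : nat -> C) (b : nat -> R) :
  (forall n, (Cmod (a n) <= b n)%R) -> ex_series b ->
  ex_series a /\ (Cmod (CSeries a) <= Series b)%R.
Proof.
  intros H Hb.
  assert (Ha : ex_series a)
    by exact (@ex_series_le C_AbsRing C_CompleteNormedModule a b H Hb).
  split; [exact Ha |].
  apply (is_lim_seq_le (fun n => Cmod (sum_n a n)) (sum_n b)
           (Cmod (CSeries a)) (Series b)).
  - intros n; eapply Rle_trans.
    + exact (@norm_sum_n_m C_AbsRing C_NormedModule a 0 n).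
    + now apply sum_n_m_le.
  - apply is_lim_seq_Cmod, (CSeries_correct a Ha).
  - exact (Series_correct b Hb).
Qed.

Lemma is_series_partial_sums (a s : nat -> C) (l : C) :
  (forall n, @eq C (sum_n a n) (s n)) -> filterlim s eventually (locally l) ->
  is_series a l.
Proof.
  intros H Hs; unfold is_series.
  apply filterlim_ext with (2 := Hs); intros n; symmetry; apply H.
Qed.

Lemma sum_n_CS (a : nat -> C) (n : nat) :
  sum_n a (S n) = sum_n a n + a (S n).
Proof. exact (sum_Sn a n). Qed.

Lemma is_lim_seq_geom_scal (r k : R) :
  (0 <= r < 1)%R -> is_lim_seq (fun n => r ^ n * k)%R 0.
Proof.
  intros Hr; replace (Finite 0) with (Finite (0 * k)%R) by (f_equal; ring).
  apply is_lim_seq_mult'; [| apply is_lim_seq_const].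
  apply is_lim_seq_geom; rewrite Rabs_pos_eq; lra.
Qed.

Lemma exp_le_compat (x y : R) : (x <= y)%R -> (exp x <= exp y)%R.
Proof.
  intros [H | ->]; [now apply Rlt_le, exp_increasing | apply Rle_refl].
Qed.

Lemma pow_le_1 (r : R) (n : nat) : (0 <= r <= 1)%R -> (r ^ n <= 1)%R.
Proof. intros H; rewrite <- (pow1 n); apply pow_incr; lra. Qed.

(** * Finite q-Pochhammer symbols: splitting rules and bounds uniform in the length *)

Lemma qpoch_shift (A q : C) (n : nat) :
  qpoch A q (S n) = (1 - A) * qpoch (A * q) q n.
Proof.
  induction n as [|n IH]; [simpl; ring |].
  change (qpoch A q (S n) * (1 - A * q ^ S n)
          = (1 - A) * (qpoch (A * q) q n * (1 - A * q * q ^ n))).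
  rewrite IH, Cpow_S; ring.
Qed.

Lemma qpoch_add (A q : C) (m n : nat) :
  qpoch A q (m + n) = qpoch A q m * qpoch (A * q ^ m) q n.
Proof.
  induction n as [|n IH]; [rewrite Nat.add_0_r; simpl; ring |].
  rewrite Nat.add_succ_r; simpl; rewrite IH, Cpow_add_r; ring.
Qed.

(** Each factor has modulus at most 1 + Q |q|^i <= exp (Q |q|^i), and the exponents form a geometric
    series. Stating it with [Q] instead of [Cmod A] gives one constant for a whole orbit
    [c * q ^ k]. *)
Lemma qpoch_Cmod_le (A q : C) (Q : R) (n : nat) :
  (Cmod q < 1)%R -> (Cmod A <= Q)%R ->
  (Cmod (qpoch A q n) <= exp (Q / (1 - Cmod q)))%R.
Proof.
  intros hq hA; pose proof (Cmod_ge_0 q) as h0; pose proof (Cmod_ge_0 A) as hA0.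
  (* The final bound does not propagate by induction; the one with the partial geometric sum
     does. *)
  apply Rle_trans with (exp (Q * (1 - Cmod q ^ n) / (1 - Cmod q)))%R.
  - induction n as [|n IH].
    + simpl; rewrite Cmod_1; unfold Rdiv.
      replace (Q * (1 - 1) * / (1 - Cmod q))%R with 0%R by ring.
      rewrite exp_0; lra.
    + simpl qpoch; rewrite Cmod_mult.
      replace (Q * (1 - Cmod q ^ S n) / (1 - Cmod q))%R
        with (Q * (1 - Cmod q ^ n) / (1 - Cmod q) + Q * Cmod q ^ n)%R
        by (simpl; field; lra).
      rewrite exp_plus.
      apply Rmult_le_compat; try apply Cmod_ge_0; [exact IH |].
      eapply Rle_trans; [apply Cmod_triangle |].
      rewrite Cmod_opp, Cmod_1, Cmod_mult, Cmod_pow.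
      eapply Rle_trans; [| apply exp_ineq1_le].
      apply Rplus_le_compat_l, Rmult_le_compat_r; [apply pow_le |]; lra.
  - apply exp_le_compat.
    apply Rmult_le_compat_r; [apply Rlt_le, Rinv_0_lt_compat; lra |].
    pose proof (pow_le (Cmod q) n h0); nra.
Qed.

(** The increments (A)_(i+1) - (A)_i = - A q^i (A)_i are summed. The factor [Cmod A] is kept outside
    because smallness in [A] is what the limits below need. *)
Lemma qpoch_sub_1_le (A q : C) (Q : R) (n : nat) :
  (Cmod q < 1)%R -> (Cmod A <= Q)%R ->
  (Cmod (qpoch A q n - 1)
   <= Cmod A * (exp (Q / (1 - Cmod q)) / (1 - Cmod q)))%R.
Proof.
  intros hq hA; pose proof (Cmod_ge_0 q) as h0; pose proof (Cmod_ge_0 A) as hA0.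
  set (M := exp (Q / (1 - Cmod q))).
  assert (hM : (0 < M)%R) by apply exp_pos.
  apply Rle_trans with (Cmod A * (M * (1 - Cmod q ^ n) / (1 - Cmod q)))%R.
  - induction n as [|n IH].
    + simpl; replace (1 - 1) with (RtoC 0) by ring; rewrite Cmod_0.
      right; field; lra.
    + replace (qpoch A q (S n) - 1)
        with ((qpoch A q n - 1) + - (qpoch A q n * (A * q ^ n)))
        by (simpl; ring).
      eapply Rle_trans; [apply Cmod_triangle |].
      rewrite Cmod_opp, !Cmod_mult, Cmod_pow.
      replace (Cmod A * (M * (1 - Cmod q ^ S n) / (1 - Cmod q)))%R
        with (Cmod A * (M * (1 - Cmod q ^ n) / (1 - Cmod q))
              + M * (Cmod A * Cmod q ^ n))%R
        by (simpl; field; lra).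
      apply Rplus_le_compat; [exact IH |].
      apply Rmult_le_compat_r.
      * apply Rmult_le_pos; [lra | now apply pow_le].
      * now apply qpoch_Cmod_le.
  - apply Rmult_le_compat_l; [exact hA0 |].
    apply Rmult_le_compat_r; [apply Rlt_le, Rinv_0_lt_compat; lra |].
    pose proof (pow_le (Cmod q) n h0); nra.
Qed.

Lemma Cmod_1_sub_pow_ge (q : C) (n : nat) :
  (Cmod q < 1)%R -> (1 - Cmod q <= Cmod (1 - q ^ S n))%R.
Proof.
  intros hq; pose proof (Cmod_ge_0 q) as h0.
  assert (H : (Cmod 1 <= Cmod (1 - q ^ S n) + Cmod (q ^ S n))%R).
  { replace (RtoC 1) with ((1 - q ^ S n) + q ^ S n) at 1 by ring.
    apply Cmod_triangle. }
  rewrite Cmod_1, Cmod_pow in H; simpl in H |- *.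
  pose proof (pow_le_1 (Cmod q) n ltac:(lra)); nra.
Qed.

Lemma C1_sub_pow_neq_0 (q : C) (n : nat) :
  (Cmod q < 1)%R -> 1 - q ^ S n <> 0.
Proof.
  intros hq; apply Cmod_gt_0.
  pose proof (Cmod_1_sub_pow_ge q n hq); lra.
Qed.

Lemma Cmod_inv_1_sub_pow_le (q : C) (n : nat) :
  (Cmod q < 1)%R -> (Cmod (/ (1 - q ^ S n)) <= / (1 - Cmod q))%R.
Proof.
  intros hq; rewrite Cmod_inv by now apply C1_sub_pow_neq_0.
  apply Rinv_le_contravar; [lra | now apply Cmod_1_sub_pow_ge].
Qed.

Lemma qpoch_q_neq_0 (q : C) (n : nat) : (Cmod q < 1)%R -> qpoch q q n <> 0.
Proof.
  intros hq; induction n as [|n IH]; simpl.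
  - apply Cmod_gt_0; rewrite Cmod_1; lra.
  - apply Cmult_neq_0; [exact IH | now apply (C1_sub_pow_neq_0 q n)].
Qed.

Lemma Cmod_inv_qpoch_q_le (q : C) (n : nat) :
  (Cmod q < 1)%R -> (Cmod (/ qpoch q q n) <= (/ (1 - Cmod q)) ^ n)%R.
Proof.
  intros hq; induction n as [|n IH].
  - simpl; rewrite Cmod_inv, Cmod_1 by (apply Cmod_gt_0; rewrite Cmod_1; lra).
    lra.
  - replace (/ qpoch q q (S n)) with (/ (1 - q ^ S n) * / qpoch q q n).
    + rewrite Cmod_mult; apply Rmult_le_compat; try apply Cmod_ge_0;
        [now apply Cmod_inv_1_sub_pow_le | exact IH].
    + simpl; field; split;
        [now apply (C1_sub_pow_neq_0 q n) | now apply qpoch_q_neq_0].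
Qed.

(** * Euler's expansion of the infinite product *)

Lemma triangular_S (n : nat) :
  (S n * (S n - 1) / 2 = n + n * (n - 1) / 2)%nat.
Proof.
  (* Division is that of [nat]; pulling out a multiple of 2 avoids any parity argument. *)
  replace (S n * (S n - 1))%nat with (n * 2 + n * (n - 1))%nat by nia.
  apply Nat.div_add_l; lia.
Qed.

Definition euler_term (q d : C) (n : nat) : C :=
  (- d) ^ n * q ^ (n * (n - 1) / 2) / qpoch q q n.

Lemma euler_term_scale (q d t : C) (n : nat) :
  euler_term q (d * t) n = t ^ n * euler_term q d n.
Proof.
  unfold euler_term; replace (- (d * t)) with (- d * t) by ring.
  rewrite Cpow_mult_l; unfold Cdiv; ring.
Qed.

(** The factor 1 - q^(n+1) cancels the last factor of (q)_(n+1), and the extra q^n of the triangular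
    exponent is absorbed by [d -> d * q]. *)
Lemma euler_term_S (q d : C) (n : nat) : (Cmod q < 1)%R ->
  euler_term q d (S n) * (1 - q ^ S n) = - d * euler_term q (d * q) n.
Proof.
  intros hq; rewrite euler_term_scale; unfold euler_term.
  rewrite triangular_S, Cpow_add_r.
  change (qpoch q q (S n)) with (qpoch q q n * (1 - q ^ S n)).
  change ((- d) ^ S n) with (- d * (- d) ^ n).
  field; split; [now apply qpoch_q_neq_0 | now apply C1_sub_pow_neq_0].
Qed.

(** Ratio test: consecutive terms have ratio D r^n, which tends to 0. *)
Lemma ex_series_triangular_pow (r D : R) : (0 < r < 1)%R -> (0 < D)%R ->
  ex_series (fun n => D ^ n * r ^ (n * (n - 1) / 2))%R.
Proof.
  intros Hr HD.
  assert (Hp : forall n, (0 < D ^ n * r ^ (n * (n - 1) / 2))%R)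
    by (intros n; apply Rmult_lt_0_compat; apply pow_lt; lra).
  eapply ex_series_ext;
    [| apply (ex_series_DAlembert
                (fun n => D ^ n * r ^ (n * (n - 1) / 2))%R 0)].
  - intros n; apply Rabs_pos_eq, Rlt_le, Hp.
  - lra.
  - intros n; apply Rgt_not_eq, Hp.
  - apply is_lim_seq_ext with (fun n => r ^ n * D)%R;
      [| apply is_lim_seq_geom_scal; lra].
    intros n; rewrite triangular_S, pow_add.
    rewrite Rabs_pos_eq.
    + simpl; field; split; apply Rgt_not_eq, pow_lt; lra.
    + specialize (Hp (S n)); rewrite triangular_S, pow_add in Hp.
      apply Rlt_le, Rdiv_lt_0_compat; [exact Hp |].
      apply Rmult_lt_0_compat; apply pow_lt; lra.
Qed.

Lemma ex_series_Cmod_euler_term (q d : C) : (Cmod q < 1)%R -> q <> 0 ->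
  ex_series (fun n => Cmod (euler_term q d (S n))).
Proof.
  intros hq hq0; apply Cmod_gt_0 in hq0 as h0.
  pose proof (Cmod_ge_0 d) as hd.
  assert (hi : (0 < / (1 - Cmod q))%R) by (apply Rinv_0_lt_compat; lra).
  apply (@ex_series_incr_1 R_AbsRing R_NormedModule
           (fun n => Cmod (euler_term q d n))).
  (* The base comes from bounding 1 / (q)_n by (1 - |q|)^(-n); adding 1 keeps it positive when [d]
     is 0, as the ratio test requires. *)
  apply @ex_series_le
    with (fun n => (Cmod d * / (1 - Cmod q) + 1) ^ n
                   * Cmod q ^ (n * (n - 1) / 2))%R;
    [| apply ex_series_triangular_pow; nra].
  intros n; change norm with Rabs; rewrite Rabs_pos_eq by apply Cmod_ge_0.
  unfold euler_term, Cdiv; rewrite !Cmod_mult, !Cmod_pow, Cmod_opp.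
  pose proof (pow_le _ (n * (n - 1) / 2) (Rlt_le _ _ h0)) as hp.
  apply Rle_trans
    with ((Cmod d * / (1 - Cmod q)) ^ n * Cmod q ^ (n * (n - 1) / 2))%R.
  - rewrite Rpow_mult_distr.
    pose proof (Cmod_inv_qpoch_q_le q n hq).
    pose proof (pow_le _ n hd).
    assert (0 <= Cmod d ^ n * Cmod q ^ (n * (n - 1) / 2))%R
      by now apply Rmult_le_pos.
    nra.
  - apply Rmult_le_compat_r; [exact hp | apply pow_incr; split; nra].
Qed.

(** Replacing [d] by [d * t] multiplies the term of index n >= 1 by t^n, and |t|^n <= |t|. With t =
    q^k this gives geometric decay along the orbit; with t = 1 it gives plain convergence. *)
Lemma CSeries_euler_weighted (q d t : C) (h : nat -> C) (B : R) :
  (Cmod q < 1)%R -> q <> 0 -> (Cmod t <= 1)%R ->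
  (forall n, (Cmod (h n) <= B)%R) ->
  ex_series (fun n => euler_term q (d * t) (S n) * h n)
  /\ (Cmod (CSeries (fun n => euler_term q (d * t) (S n) * h n)%C)
      <= Cmod t * (B * Series (fun n => Cmod (euler_term q d (S n)))))%R.
Proof.
  intros hq hq0 ht hh; pose proof (Cmod_ge_0 t) as ht0.
  rewrite <- Rmult_assoc, <- Series_scal_l.
  apply CSeries_dominated.
  - intros n; rewrite euler_term_scale, !Cmod_mult, Cmod_pow; simpl pow.
    pose proof (pow_le_1 (Cmod t) n ltac:(lra)) as h1.
    pose proof (pow_le (Cmod t) n ht0) as h2.
    pose proof (Cmod_ge_0 (euler_term q d (S n))) as h3.
    pose proof (hh n) as h4; pose proof (Cmod_ge_0 (h n)) as h5.
    replace (Cmod t * B * Cmod (euler_term q d (S n)))%R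
      with (Cmod t * 1 * Cmod (euler_term q d (S n)) * B)%R by ring.
    repeat apply Rmult_le_compat; try lra; repeat apply Rmult_le_pos; lra.
  - apply (@ex_series_scal R_AbsRing R_NormedModule (Cmod t * B)%R).
    now apply ex_series_Cmod_euler_term.
Qed.

Lemma Cmod_mul_pow_le (c q : C) (k : nat) :
  (Cmod q < 1)%R -> (Cmod (c * q ^ k) <= Cmod c)%R.
Proof.
  intros hq; pose proof (Cmod_ge_0 q); pose proof (Cmod_ge_0 c).
  rewrite Cmod_mult, Cmod_pow.
  pose proof (pow_le_1 (Cmod q) k ltac:(lra)); nra.
Qed.

Lemma Cmod_pow_le_1 (q : C) (k : nat) :
  (Cmod q < 1)%R -> (Cmod (q ^ k) <= 1)%R.
Proof.
  intros hq; rewrite Cmod_pow; apply pow_le_1.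
  pose proof (Cmod_ge_0 q); lra.
Qed.

Definition euler_sum (q d : C) : C :=
  1 + CSeries (fun n => euler_term q d (S n)).

Lemma ex_series_euler_term (q d : C) : (Cmod q < 1)%R -> q <> 0 ->
  ex_series (fun n => euler_term q d (S n)).
Proof.
  intros hq hq0.
  apply (CSeries_dominated _ _ (fun n => Rle_refl _)).
  now apply ex_series_Cmod_euler_term.
Qed.

Lemma is_series_euler_term (q d : C) : (Cmod q < 1)%R -> q <> 0 ->
  is_series (euler_term q d) (euler_sum q d).
Proof.
  intros hq hq0; unfold euler_sum.
  replace (RtoC 1) with (euler_term q d 0) at 1.
  - now apply is_series_Cfirst, CSeries_correct, ex_series_euler_term.
  - unfold euler_term; simpl; field.
Qed.

(** Termwise, e_(n+1) d - e_(n+1) (dq) = (1 - q^(n+1)) e_(n+1) d = - d e_n (dq), by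
    [euler_term_S]. *)
Lemma euler_sum_rec (q d : C) : (Cmod q < 1)%R -> q <> 0 ->
  euler_sum q d = (1 - d) * euler_sum q (d * q).
Proof.
  intros hq hq0.
  enough (H : euler_sum q d - euler_sum q (d * q) = - d * euler_sum q (d * q)).
  { replace (euler_sum q d)
      with ((euler_sum q d - euler_sum q (d * q)) + euler_sum q (d * q)) by ring.
    rewrite H; ring. }
  pose proof (is_series_euler_term q (d * q) hq hq0) as H1.
  rewrite <- (CSeries_unique _ _ (is_series_Cminus _ _ _ _
                (is_series_euler_term q d hq hq0) H1)).
  apply CSeries_unique.
  (* The added difference of constant terms is 1 - 1; it exposes the term of index 0 for
     [is_series_Cfirst]. *)
  replace (- d * euler_sum q (d * q))
    with ((euler_term q d 0 - euler_term q (d * q) 0)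
          + - d * euler_sum q (d * q)) by (unfold euler_term; simpl; ring).
  apply is_series_Cfirst.
  eapply is_series_Cext; [| apply is_series_Cscal, H1].
  intros n; cbv beta; rewrite <- euler_term_S, (euler_term_scale q d q (S n)) by easy.
  ring.
Qed.

Lemma euler_sum_iter (q d : C) (n : nat) : (Cmod q < 1)%R -> q <> 0 ->
  euler_sum q d = qpoch d q n * euler_sum q (d * q ^ n).
Proof.
  intros hq hq0; induction n as [|n IH]; simpl; [rewrite !Cmult_1_r; ring |].
  rewrite IH, (euler_sum_rec q (d * q ^ n)) by easy.
  replace (d * q ^ n * q) with (d * (q * q ^ n)) by ring; ring.
Qed.

(** By [euler_sum_iter] the error is (d)_n times 1 minus the Euler sum at d q^n: a bounded factor
    times one of order |q|^n. Convergence of the product and the value of its limit thus come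
    together. *)
Lemma filterlim_qpoch_euler (q d : C) : (Cmod q < 1)%R -> q <> 0 ->
  filterlim (qpoch d q) eventually (locally (euler_sum q d)).
Proof.
  intros hq hq0; pose proof (Cmod_ge_0 q) as h0.
  set (M := exp (Cmod d / (1 - Cmod q))).
  set (T := Series (fun n => Cmod (euler_term q d (S n)))).
  apply filterlim_C_squeeze with (fun n => Cmod q ^ n * (M * T))%R;
    [| apply is_lim_seq_geom_scal; lra].
  intros n.
  rewrite (euler_sum_iter q d n) by easy; unfold euler_sum.
  match goal with |- context [CSeries ?f] => set (s := CSeries f) end.
  replace (qpoch d q n - qpoch d q n * (1 + s)) with (- (qpoch d q n * s))
    by ring.
  rewrite Cmod_opp, Cmod_mult.
  assert (Hs : (Cmod s <= Cmod q ^ n * T)%R).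
  { destruct (CSeries_euler_weighted q d (q ^ n) (fun _ => 1) 1 hq hq0)
      as [_ H].
    - now apply Cmod_pow_le_1.
    - intros _; rewrite Cmod_1; lra.
    - rewrite Cmod_pow, Rmult_1_l in H.
      eapply Rle_trans; [right | exact H]; unfold s; f_equal.
      apply CSeries_ext; intros k; ring. }
  assert (HM : (Cmod (qpoch d q n) <= M)%R)
    by (apply qpoch_Cmod_le; [exact hq | apply Rle_refl]).
  replace (Cmod q ^ n * (M * T))%R with (M * (Cmod q ^ n * T))%R by ring.
  apply Rmult_le_compat; auto; apply Cmod_ge_0.
Qed.

Lemma qpoch_inf_euler (q d : C) : (Cmod q < 1)%R -> q <> 0 ->
  qpoch_inf d q = euler_sum q d.
Proof. now intros hq hq0; apply CLim_unique, filterlim_qpoch_euler. Qed.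

Lemma filterlim_qpoch (q d : C) : (Cmod q < 1)%R -> q <> 0 ->
  filterlim (qpoch d q) eventually (locally (qpoch_inf d q)).
Proof.
  now intros hq hq0; rewrite qpoch_inf_euler; [apply filterlim_qpoch_euler | |].
Qed.

(** This turns the quotients (b)_oo / (b)_n and (d)_oo / (d)_n of the left-hand side into tails. *)
Lemma qpoch_inf_split (q d : C) (n : nat) : (Cmod q < 1)%R -> q <> 0 ->
  qpoch_inf d q = qpoch d q n * qpoch_inf (d * q ^ n) q.
Proof.
  now intros hq hq0; rewrite !qpoch_inf_euler by easy; apply euler_sum_iter.
Qed.

(** * The sums [H_n] and their functional equation *)

Lemma CSeries_geom_dominated (a : nat -> C) (r k : R) : (0 <= r < 1)%R ->
  (forall n, (Cmod (a n) <= k * r ^ n)%R) ->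
  ex_series a /\ (Cmod (CSeries a) <= k * / (1 - r))%R.
Proof.
  intros Hr Ha; assert (Hr' : (Rabs r < 1)%R) by (rewrite Rabs_pos_eq; lra).
  rewrite <- (Series_geom r Hr'), <- Series_scal_l.
  apply CSeries_dominated; [exact Ha |].
  apply (@ex_series_scal R_AbsRing R_NormedModule k (fun n => r ^ n)%R).
  exists (/ (1 - r))%R; now apply is_series_geom.
Qed.

(* The index is shifted: [n] and [c] here correspond to the series [H_(n+1) c]
   of the header. *)
Definition heine_term (q : C) (n : nat) (c : C) (m : nat) : C :=
  qpoch (q ^ S m) q n * qpoch c q m * q ^ m.

Definition heine_sum (q : C) (n : nat) (c : C) : C :=
  CSeries (heine_term q n c).

(** The factors bound (q^(m+1))_n, (c)_m and the geometric sum of |q|^m; none depends on n. *)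
Definition heine_bound (q : C) (Q : R) : R :=
  (exp (1 / (1 - Cmod q)) * exp (Q / (1 - Cmod q)) * / (1 - Cmod q))%R.

Lemma heine_sum_dominated (q : C) (n : nat) (c : C) (Q : R) :
  (Cmod q < 1)%R -> (Cmod c <= Q)%R ->
  ex_series (heine_term q n c)
  /\ (Cmod (heine_sum q n c) <= heine_bound q Q)%R.
Proof.
  intros hq hc; apply CSeries_geom_dominated.
  - pose proof (Cmod_ge_0 q); lra.
  - intros m; unfold heine_term; rewrite !Cmod_mult, Cmod_pow.
    apply Rmult_le_compat_r; [apply pow_le, Cmod_ge_0 |].
    apply Rmult_le_compat; try apply Cmod_ge_0; apply qpoch_Cmod_le; auto.
    now apply Cmod_pow_le_1.
Qed.

(** The values at M and M + 1 share the factor (q^(M+2))_n (cq)_M. Once it is taken out, the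
    telescoping step is the polynomial identity (1 - x q^(n+1)) (1 - c x) - (1 - x) = x (1 - c) - x
    q^(n+1) (1 - c x) at x = q^(M+1). *)
Lemma sum_n_heine (q : C) (n : nat) (c : C) (M : nat) :
  sum_n (fun m => heine_term q n c m - q ^ S n * heine_term q n (c * q) m) M
  = qpoch (q ^ S M) q (S n) * qpoch (c * q) q M.
Proof.
  induction M as [|M IH].
  - rewrite sum_O; unfold heine_term; simpl; ring.
  - rewrite sum_n_CS, IH, (qpoch_shift (q ^ S M)).
    unfold heine_term; rewrite (qpoch_shift c).
    replace (q ^ S M * q) with (q ^ S (S M)) by (simpl; ring).
    change (qpoch (q ^ S (S M)) q (S n))
      with (qpoch (q ^ S (S M)) q n * (1 - q ^ S (S M) * q ^ n)).
    simpl (qpoch (c * q) q (S M)).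
    generalize (qpoch (q ^ S (S M)) q n); intros P; simpl; ring.
Qed.

(** This disposes of the first factor in [sum_n_heine], so that only (cq)_oo survives in the
    limit. *)
Lemma filterlim_qpoch_pow_S (q : C) (n : nat) : (Cmod q < 1)%R ->
  filterlim (fun M => qpoch (q ^ S M) q n) eventually (locally (RtoC 1)).
Proof.
  intros hq; pose proof (Cmod_ge_0 q) as h0.
  set (K := (exp (1 / (1 - Cmod q)) / (1 - Cmod q))%R).
  apply filterlim_C_squeeze with (fun M => Cmod q ^ M * (Cmod q * K))%R;
    [| apply is_lim_seq_geom_scal; lra].
  intros M; replace (Cmod q ^ M * (Cmod q * K))%R with (Cmod (q ^ S M) * K)%R
    by (rewrite Cmod_pow; simpl; ring).
  apply qpoch_sub_1_le; [exact hq | now apply Cmod_pow_le_1].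
Qed.

Lemma heine_sum_rec (q : C) (n : nat) (c : C) : (Cmod q < 1)%R -> q <> 0 ->
  heine_sum q n c - q ^ S n * heine_sum q n (c * q) = qpoch_inf (c * q) q.
Proof.
  intros hq hq0; unfold heine_sum.
  destruct (heine_sum_dominated q n c _ hq (Rle_refl _)) as [H1 _].
  destruct (heine_sum_dominated q n (c * q) _ hq (Rle_refl _)) as [H2 _].
  rewrite <- (CSeries_unique _ _ (is_series_Cminus _ _ _ _
    (CSeries_correct _ H1) (is_series_Cscal (q ^ S n) _ _ (CSeries_correct _ H2)))).
  apply CSeries_unique.
  apply is_series_partial_sums with (1 := sum_n_heine q n c).
  rewrite <- (Cmult_1_l (qpoch_inf (c * q) q)).
  apply filterlim_Cmult; [now apply filterlim_qpoch_pow_S |].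
  now apply filterlim_qpoch.
Qed.

(** * The sum [L] and its functional equation *)

Definition lambert_term (q c : C) (m : nat) : C :=
  (1 - qpoch c q (S m)) * q ^ S m / (1 - q ^ S m).

(** The constant of [qpoch_sub_1_le], then one factor for the denominator 1 - q^(m+1) and one for
    the geometric sum. *)
Definition lambert_bound (q : C) (Q : R) : R :=
  (exp (Q / (1 - Cmod q)) / (1 - Cmod q) * / (1 - Cmod q)
   * / (1 - Cmod q))%R.

Lemma Cmod_pow_S_le (q : C) (m : nat) : (Cmod q < 1)%R ->
  (Cmod (q ^ S m) <= Cmod q ^ m)%R.
Proof.
  intros hq; rewrite Cmod_pow; simpl.
  pose proof (pow_le (Cmod q) m (Cmod_ge_0 q)); nra.
Qed.

(** The numerator 1 - (c)_(m+1) vanishes at c = 0, whence the factor [Cmod c], which becomes |q|^k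
    along the orbit. *)
Lemma lambert_sum_dominated (q c : C) (Q : R) :
  (Cmod q < 1)%R -> (Cmod c <= Q)%R ->
  ex_series (lambert_term q c)
  /\ (Cmod (CSeries (lambert_term q c)) <= Cmod c * lambert_bound q Q)%R.
Proof.
  intros hq hc; unfold lambert_bound.
  rewrite <- Rmult_assoc; apply CSeries_geom_dominated.
  - pose proof (Cmod_ge_0 q); lra.
  - intros m; unfold lambert_term, Cdiv; rewrite !Cmod_mult.
    replace (1 - qpoch c q (S m)) with (- (qpoch c q (S m) - 1)) by ring.
    rewrite Cmod_opp.
    set (K := (exp (Q / (1 - Cmod q)) / (1 - Cmod q))%R).
    replace (Cmod c * (K * / (1 - Cmod q)) * Cmod q ^ m)%R
      with (Cmod c * K * Cmod q ^ m * / (1 - Cmod q))%R by ring.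
    repeat apply Rmult_le_compat; try apply Rmult_le_pos; try apply Cmod_ge_0.
    + now apply qpoch_sub_1_le.
    + now apply Cmod_pow_S_le.
    + now apply Cmod_inv_1_sub_pow_le.
Qed.

Lemma sum_n_lambert (q c : C) (M : nat) : (Cmod q < 1)%R ->
  sum_n (fun m => lambert_term q c m - lambert_term q (c * q) m) M
  = 1 - qpoch (c * q) q (S M).
Proof.
  intros hq.
  (* Here (cq)_(m+1) - (c)_(m+1) = c (1 - q^(m+1)) (cq)_m, so the denominator cancels; what remains
     equals (cq)_m - (cq)_(m+1) and telescopes. *)
  assert (T : forall m, lambert_term q c m - lambert_term q (c * q) m
                        = c * q ^ S m * qpoch (c * q) q m).
  { intros m; unfold lambert_term; rewrite (qpoch_shift c).
    simpl (qpoch (c * q) q (S m)); rewrite !Cpow_S; field.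
    now apply (C1_sub_pow_neq_0 q m). }
  induction M as [|M IH].
  - rewrite sum_O, T; simpl; ring.
  - rewrite sum_n_CS, IH, T; simpl; ring.
Qed.

Lemma lambert_sum_rec (q c : C) : (Cmod q < 1)%R -> q <> 0 ->
  CSeries (lambert_term q c) - CSeries (lambert_term q (c * q))
  = 1 - qpoch_inf (c * q) q.
Proof.
  intros hq hq0.
  destruct (lambert_sum_dominated q c _ hq (Rle_refl _)) as [H1 _].
  destruct (lambert_sum_dominated q (c * q) _ hq (Rle_refl _)) as [H2 _].
  rewrite <- (CSeries_unique _ _ (is_series_Cminus _ _ _ _
    (CSeries_correct _ H1) (CSeries_correct _ H2))).
  apply CSeries_unique.
  apply is_series_partial_sums with (1 := fun M => sum_n_lambert q c M hq).
  apply filterlim_C_iff.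
  apply is_lim_seq_ext
    with (fun M => Cmod (qpoch (c * q) q (S M) - qpoch_inf (c * q) q)).
  - intros M; rewrite <- Cmod_opp; f_equal; ring.
  - apply (is_lim_seq_incr_1
             (fun M => Cmod (qpoch (c * q) q M - qpoch_inf (c * q) q))).
    now apply filterlim_C_iff, filterlim_qpoch.
Qed.

(** * The function [U] and its telescoping along the orbit *)

Definition defect_sum (q c d : C) : C :=
  CSeries (lambert_term q c)
  - CSeries (fun n => euler_term q d (S n) * heine_sum q n c).

Lemma ex_series_euler_heine (q c d : C) : (Cmod q < 1)%R -> q <> 0 ->
  ex_series (fun n => euler_term q d (S n) * heine_sum q n c).
Proof.
  intros hq hq0; rewrite <- (Cmult_1_r d).
  apply (CSeries_euler_weighted q d 1 _ (heine_bound q (Cmod c))); auto.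
  - rewrite Cmod_1; lra.
  - intros n; apply heine_sum_dominated; auto; apply Rle_refl.
Qed.

Lemma defect_sum_rec (q c d : C) : (Cmod q < 1)%R -> q <> 0 ->
  defect_sum q c d - defect_sum q (c * q) (d * q)
  = 1 - qpoch_inf (c * q) q * qpoch_inf d q.
Proof.
  intros hq hq0; unfold defect_sum.
  (* The q^n from e_n (dq) is exactly the one in the recurrence for [H_n], so each difference
     collapses to e_n d times (cq)_oo; Euler's expansion without its constant term then sums
     these. *)
  assert (H : CSeries (fun n => euler_term q d (S n) * heine_sum q n c)
              - CSeries (fun n => euler_term q (d * q) (S n)
                                  * heine_sum q n (c * q))
              = qpoch_inf (c * q) q * (qpoch_inf d q - 1)).
  { rewrite <- (CSeries_unique _ _ (is_series_Cminus _ _ _ _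
      (CSeries_correct _ (ex_series_euler_heine q c d hq hq0))
      (CSeries_correct _ (ex_series_euler_heine q (c * q) (d * q) hq hq0)))).
    apply CSeries_unique.
    replace (qpoch_inf d q - 1) with (CSeries (fun n => euler_term q d (S n)))
      by (rewrite qpoch_inf_euler by easy; unfold euler_sum; ring).
    eapply is_series_Cext; [| apply is_series_Cscal, CSeries_correct;
                             now apply ex_series_euler_term].
    intros n; cbv beta; rewrite <- (heine_sum_rec q n c) by easy.
    rewrite euler_term_scale; ring. }
  pose proof (lambert_sum_rec q c hq hq0) as HL.
  match type of HL with ?a - ?b = _ => match type of H with ?x - ?y = _ =>
    transitivity ((a - b) - (x - y)); [ring | rewrite H, HL; ring] end end.
Qed.

(** The decay comes from [c] in the Lambert part and from [d] in the Euler part; the bound on [H_n]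
    only has to be uniform over the orbit. *)
Lemma Cmod_defect_sum_le (q c d : C) (k : nat) : (Cmod q < 1)%R -> q <> 0 ->
  (Cmod (defect_sum q (c * q ^ k) (d * q ^ k))
   <= Cmod q ^ k
      * (Cmod c * lambert_bound q (Cmod c)
         + heine_bound q (Cmod c)
           * Series (fun n => Cmod (euler_term q d (S n)))))%R.
Proof.
  intros hq hq0; unfold defect_sum.
  eapply Rle_trans; [apply Cmod_triangle |]; rewrite Cmod_opp.
  rewrite Rmult_plus_distr_l; apply Rplus_le_compat.
  - destruct (lambert_sum_dominated q (c * q ^ k) (Cmod c) hq
                (Cmod_mul_pow_le c q k hq)) as [_ H].
    rewrite Cmod_mult, Cmod_pow in H.
    eapply Rle_trans; [exact H | right; ring].
  - rewrite <- Cmod_pow.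
    apply CSeries_euler_weighted; auto; [now apply Cmod_pow_le_1 |].
    intros n; apply heine_sum_dominated; auto; now apply Cmod_mul_pow_le.
Qed.

Lemma is_series_defect (q c d : C) : (Cmod q < 1)%R -> q <> 0 ->
  is_series (fun n => 1 - qpoch_inf (c * q * q ^ n) q * qpoch_inf (d * q ^ n) q)
    (defect_sum q c d).
Proof.
  intros hq hq0; pose proof (Cmod_ge_0 q) as h0.
  apply is_series_partial_sums
    with (fun N => defect_sum q c d
                   - defect_sum q (c * q ^ S N) (d * q ^ S N)).
  - assert (T : forall n,
      1 - qpoch_inf (c * q * q ^ n) q * qpoch_inf (d * q ^ n) q
      = defect_sum q (c * q ^ n) (d * q ^ n)
        - defect_sum q (c * q ^ S n) (d * q ^ S n)).
    { intros n; simpl.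
      replace (c * (q * q ^ n)) with (c * q ^ n * q) by ring.
      replace (d * (q * q ^ n)) with (d * q ^ n * q) by ring.
      rewrite defect_sum_rec by easy.
      now replace (c * q ^ n * q) with (c * q * q ^ n) by ring. }
    induction n as [|n IH].
    + rewrite sum_O, T; simpl; now rewrite !Cmult_1_r.
    + rewrite sum_n_CS, IH, T; ring.
  - match goal with |- filterlim _ _ (locally ?l) => set (D := l) end.
    apply filterlim_C_squeeze with (fun N => (Cmod q ^ N * (Cmod q
      * (Cmod c * lambert_bound q (Cmod c)
         + heine_bound q (Cmod c)
           * Series (fun n => Cmod (euler_term q d (S n))))))%R);
      [| apply is_lim_seq_geom_scal; lra].
    intros N.
    replace (D - defect_sum q (c * q ^ S N) (d * q ^ S N) - D)
      with (- defect_sum q (c * q ^ S N) (d * q ^ S N)) by ring.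
    rewrite Cmod_opp.
    eapply Rle_trans; [now apply Cmod_defect_sum_le | right; simpl; ring].
Qed.

(** * Identification of the braces with [U] *)

Lemma ex_series_lambert (q : C) : (Cmod q < 1)%R ->
  ex_series (fun k => q ^ S k / (1 - q ^ S k)).
Proof.
  intros hq; apply (CSeries_geom_dominated _ (Cmod q) (/ (1 - Cmod q))).
  - pose proof (Cmod_ge_0 q); lra.
  - intros k; unfold Cdiv; rewrite Cmod_mult, Rmult_comm.
    apply Rmult_le_compat; try apply Cmod_ge_0.
    + now apply Cmod_inv_1_sub_pow_le.
    + now apply Cmod_pow_S_le.
Qed.

Lemma is_series_lambert_qpoch (q c : C) : (Cmod q < 1)%R ->
  is_series (fun m => qpoch c q (S m) * q ^ S m / (1 - q ^ S m))
    (CSeries (fun k => q ^ S k / (1 - q ^ S k)) - CSeries (lambert_term q c)).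
Proof.
  intros hq.
  eapply is_series_Cext; [| apply is_series_Cminus; apply CSeries_correct;
    [now apply ex_series_lambert
    | now apply lambert_sum_dominated with (Q := Cmod c); [| apply Rle_refl]]].
  intros m; unfold lambert_term, Cdiv; ring.
Qed.

(* Rests on (q)_n (q^(n+1))_m = (q)_(n+m) = (q)_m (q^(m+1))_n. *)
Lemma heine_term_eq (q c : C) (n m : nat) : (Cmod q < 1)%R ->
  qpoch (q ^ S n) q m * qpoch c q m * q ^ m / qpoch q q m
  = / qpoch q q n * heine_term q n c m.
Proof.
  intros hq; unfold heine_term.
  assert (E : qpoch q q n * qpoch (q ^ S n) q m
              = qpoch q q m * qpoch (q ^ S m) q n).
  { rewrite !Cpow_S, <- !qpoch_add; f_equal; lia. }
  pose proof (qpoch_q_neq_0 q n hq) as Hn.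
  pose proof (qpoch_q_neq_0 q m hq) as Hm.
  replace (qpoch (q ^ S n) q m)
    with (/ qpoch q q n * (qpoch q q n * qpoch (q ^ S n) q m)) by (field; auto).
  rewrite E; field; auto.
Qed.

(** The inner sum starts at m = 1, and the missing term m = 0 is 1. The resulting - 1 is what later
    cancels the second sum in the braces. *)
Lemma is_series_heine_tail (q c : C) (n : nat) : (Cmod q < 1)%R ->
  is_series (fun m => qpoch (q ^ S n) q (S m) * qpoch c q (S m) * q ^ S m
                      / qpoch q q (S m))
    (/ qpoch q q n * heine_sum q n c - 1).
Proof.
  intros hq.
  set (a := fun m =>
         qpoch (q ^ S n) q m * qpoch c q m * q ^ m / qpoch q q m).
  change (is_series (fun m => a (S m)) (/ qpoch q q n * heine_sum q n c - 1)).
  replace (RtoC 1) with (a O) by (unfold a; simpl; field).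
  apply is_series_Ctail.
  apply is_series_Cext with (fun m => / qpoch q q n * heine_term q n c m).
  - intros m; symmetry; now apply heine_term_eq.
  - apply is_series_Cscal, CSeries_correct.
    now apply heine_sum_dominated with (Q := Cmod c); [| apply Rle_refl].
Qed.

Lemma euler_term_mul_qpoch (q d : C) (n : nat) : (Cmod q < 1)%R ->
  euler_term q d (S n) * qpoch q q n
  = (- d) ^ S n * q ^ (S n * (S n - 1) / 2) / (1 - q ^ S n).
Proof.
  intros hq; unfold euler_term.
  change (qpoch q q (S n)) with (qpoch q q n * (1 - q ^ S n)).
  field; split; [now apply C1_sub_pow_neq_0 | now apply qpoch_q_neq_0].
Qed.

(** These terms are Euler terms weighted by the bounded sequence (q)_n. *)
Lemma ex_series_triangular_lambert (q d : C) : (Cmod q < 1)%R -> q <> 0 ->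
  ex_series (fun n => (- d) ^ S n * q ^ (S n * (S n - 1) / 2) / (1 - q ^ S n)).
Proof.
  intros hq hq0.
  destruct (CSeries_euler_weighted q d 1 (qpoch q q)
              (exp (1 / (1 - Cmod q))) hq hq0) as [[l Hl] _].
  - rewrite Cmod_1; lra.
  - intros n; apply qpoch_Cmod_le; lra.
  - exists l; eapply is_series_Cext; [| exact Hl].
    intros n; cbv beta; rewrite Cmult_1_r; now apply euler_term_mul_qpoch.
Qed.

Theorem theorem1p1 (q b d : C)
  (hq : (Cmod q < 1)%R) (hq0 : q <> 0)
  (hbd : qpoch_inf b q * qpoch_inf d q <> 0) :
  (ex_series1 (fun k => q ^ k / (1 - q ^ k))
   /\ ex_series1 (fun n => (- d) ^ n * q ^ (n * (n - 1) / 2) / (1 - q ^ n))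
   /\ ex_series1 (fun m => qpoch (b / q) q m * q ^ m / (1 - q ^ m))
   /\ (forall n : nat, (1 <= n)%nat ->
         ex_series1 (fun m =>
           qpoch (q ^ n) q m * qpoch (b / q) q m * q ^ m / qpoch q q m))
   /\ ex_series1 (fun n =>
        (- d) ^ n * q ^ (n * (n - 1) / 2) / (1 - q ^ n)
        * CSeries1 (fun m =>
            qpoch (q ^ n) q m * qpoch (b / q) q m * q ^ m / qpoch q q m))
   /\ ex_series (fun n =>
        1 / (qpoch_inf b q * qpoch_inf d q) - 1 / (qpoch b q n * qpoch d q n)))
  /\
  CSeries (fun n =>
    1 / (qpoch_inf b q * qpoch_inf d q) - 1 / (qpoch b q n * qpoch d q n))
  = 1 / (qpoch_inf b q * qpoch_inf d q)
    * (CSeries1 (fun k => q ^ k / (1 - q ^ k))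
       - CSeries1 (fun n => (- d) ^ n * q ^ (n * (n - 1) / 2) / (1 - q ^ n))
       - CSeries1 (fun m => qpoch (b / q) q m * q ^ m / (1 - q ^ m))
       - CSeries1 (fun n =>
           (- d) ^ n * q ^ (n * (n - 1) / 2) / (1 - q ^ n)
           * CSeries1 (fun m =>
               qpoch (q ^ n) q m * qpoch (b / q) q m * q ^ m / qpoch q q m))).
Proof.
  set (c := b / q).
  assert (hb : c * q = b) by (unfold c; field; exact hq0).
  pose proof (CSeries_correct _ (ex_series_lambert q hq)) as H1.
  pose proof (CSeries_correct _ (ex_series_triangular_lambert q d hq hq0)) as H2.
  pose proof (is_series_lambert_qpoch q c hq) as H3.
  (* For n >= 1 the summand is e_n d (q)_(n-1) (H_n c / (q)_(n-1) - 1), that is, e_n d H_n c minus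
     the summand of the second sum. *)
  assert (H4 : is_series (fun n =>
      (- d) ^ S n * q ^ (S n * (S n - 1) / 2) / (1 - q ^ S n)
      * CSeries1 (fun m =>
          qpoch (q ^ S n) q m * qpoch c q m * q ^ m / qpoch q q m))
    (CSeries (fun n => euler_term q d (S n) * heine_sum q n c)
     - CSeries (fun n =>
         (- d) ^ S n * q ^ (S n * (S n - 1) / 2) / (1 - q ^ S n)))).
  { eapply is_series_Cext; [| apply is_series_Cminus;
      [apply CSeries_correct; now apply (ex_series_euler_heine q c d)
      | exact H2]].
    intros n; cbv beta.
    unfold CSeries1; rewrite (CSeries_unique _ _ (is_series_heine_tail q c n hq)).
    rewrite <- euler_term_mul_qpoch by exact hq.
    field; now apply qpoch_q_neq_0. }
  assert (H5 : is_series (fun n =>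
      1 / (qpoch_inf b q * qpoch_inf d q) - 1 / (qpoch b q n * qpoch d q n))
    (1 / (qpoch_inf b q * qpoch_inf d q) * defect_sum q c d)).
  { eapply is_series_Cext;
      [| apply is_series_Cscal, (is_series_defect q c d hq hq0)].
    intros n; cbv beta; rewrite hb.
    (* Splitting inside [hbd] as well makes (b)_n, (d)_n and both tails nonzero, as factors of a
       nonzero product. *)
    revert hbd; rewrite (qpoch_inf_split q b n), (qpoch_inf_split q d n) by easy.
    intros hbd; field.
    repeat split; intros E; apply hbd; rewrite E; ring. }
  repeat split.
  - eexists; exact H1.
  - eexists; exact H2.
  - eexists; exact H3.
  - intros [|n] Hn; [lia |].
    eexists; exact (is_series_heine_tail q c n hq).
  - eexists; exact H4.
  - eexists; exact H5.
  (* By [H3] and [H4] the first two sums cancel against parts of the third and fourth, leaving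
     [defect_sum q c d]. *)
  - rewrite (CSeries_unique _ _ H5); f_equal; unfold CSeries1 at 1 2 3 4.
    rewrite (CSeries_unique _ _ H3), (CSeries_unique _ _ H4).
    unfold defect_sum; ring.
Qed.
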